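(* Let $1\le M\le N$ and let $\beta\ge\lambda_1\ge\lambda_2\ge\cdots\ge\lambda_M\ge\alpha$ be real random variables whose ordered joint p.d.f. on the region $\beta\ge x_1\ge\cdots\ge x_M\ge\alpha$ is $$f_{\boldsymbol\lambda}(\boldsymbol x)=K\,\det\boldsymbol\Phi(\boldsymbol x)\,\det\boldsymbol\Psi(\boldsymbol x)\prod_{i=1}^{M}\xi(x_i),$$ where $K$ is the normalizing constant, $\xi$ is a function, $\boldsymbol\Phi(\boldsymbol x)\in\mathbb C^{M\times M}$ has entries $\Phi_i(x_j)$, and $\boldsymbol\Psi(\boldsymbol x)\in\mathbb C^{N\times N}$ has entries $\Psi_i(x_j)$ for $j\le M$ and constants $\bar\Psi_{i,j}$ for $M<j\le N$. Let $1\le L\le M$. Then the joint p.d.f. of $L$ arbitrary unordered eigenvalues (by symmetry, the first $L$ unordered ones, denoted $\lambda_1,\dots,\lambda_L$) is, for $x_1,\dots,x_L\in[\alpha,\beta]$, $$f^{\text{(unord)}}_{\lambda_1,\ldots,\lambda_L}(x_1,\ldots,x_L)=\frac{K}{M!}\,\mathcal T(\boldsymbol A),$$ where the $N\times N\times N$ tensor $\boldsymbol A$ has elements $$a_{i,j,k}=\begin{cases}\displaystyle\int_\alpha^\beta\varsigma_i(x)\Psi_j(x)\,\eta_k(x)\,dx& k\le M\\ 0& k>M,\ i<k\\ \bar\Psi_{j,k}& k>M,\ i\ge k,\end{cases}$$ with $$\varsigma_i(x)=\begin{cases}\Phi_i(x)\xi(x)& i\le M\\ \xi(x)& i>M,\end{cases}\qquad\eta_k(x)=\begin{cases}\delta(x-x_k)&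 k\le L\\ 1&\text{otherwise.}\end{cases}$$
   Context: The unordered eigenvalues are the random vector obtained by applying to the ordered vector $(\lambda_1,\dots,\lambda_M)$ an independent uniformly random permutation of its coordinates. For a rank-3 tensor $\boldsymbol A=\{a_{i,j,k}\}_{i,j,k=1,\dots,N}$ the pseudo-determinant is $\mathcal T(\boldsymbol A)=\sum_{\boldsymbol\mu}\operatorname{sgn}(\boldsymbol\mu)\sum_{\boldsymbol\alpha}\operatorname{sgn}(\boldsymbol\alpha)\prod_{k=1}^N a_{\mu_k,\alpha_k,k}$, where both sums run over all permutations of $\{1,\dots,N\}$. $\delta$ is the Dirac delta: $\int_\alpha^\beta g(x)\,\delta(x-x_k)\,dx$ means $g(x_k)$. The endpoints $\alpha<\beta$ may be infinite. The scalar functions $\Phi_i$ ($1\le i\le M$), $\Psi_i$ ($1\le i\le N$), $\xi$ and the constants $\bar\Psi_{i,j}$ are arbitrary, subject to the function $f_{\boldsymbol\lambda}(\boldsymbol x)=K\,\det\boldsymbol\Phi(\boldsymbol x)\,\det\boldsymbol\Psi(\boldsymbol x)\prod_{i=1}^{M}\xi(x_i)$ being a p.d.f. on the ordered region $\beta\ge x_1\ge\cdots\ge x_M\ge\alpha$ and to the integrals appearing being well defined (absolutely convergent). *)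

(* Defs.v *)
From HB Require Import structures.
From mathcomp Require Import all_boot all_order all_fingroup all_algebra.
From mathcomp Require Import complex.
From mathcomp Require Import all_classical all_reals all_analysis.

Set Implicit Arguments.
Unset Strict Implicit.
Unset Printing Implicit Defensive.
Import Order.TTheory GRing.Theory Num.Theory.
Import numFieldNormedType.Exports.

Local Open Scope classical_set_scope.
Local Open Scope ring_scope.
Local Open Scope complex_scope.

(* R^n; measurableTypeR R is R with the Borel structure that carries
   lebesgue_measure, and tuples have the product sigma-algebra. *)
Notation rtuple R n := (n.-tuple (measurableTypeR R)).

Section cons_measure.
Context {d} {T : measurableType d} {R : realType} (n : nat).
Context (m1 : {sigma_finite_measure set T -> \bar R}).
Context (m2 : {sigma_finite_measure set (n.-tuple T) -> \bar R}).

Definition tuple_cons (p : T * n.-tuple T) : n.+1.-tuple T :=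
  [tuple of p.1 :: p.2].

Lemma measurable_tuple_cons : measurable_fun setT tuple_cons.
Proof. exact: (measurable_cons measurable_fst measurable_snd). Qed.

Definition cons_measure : set (n.+1.-tuple T) -> \bar R :=
  pushforward (m1 \x m2)%E tuple_cons.

Let cons_measure0 : cons_measure set0 = 0%E.
Proof. by rewrite /cons_measure /pushforward preimage_set0 measure0. Qed.

Let cons_measure_ge0 A : (0 <= cons_measure A)%E.
Proof. exact: (measure_ge0 (m1 \x m2)%E). Qed.

Let cons_measure_sigma_additive : semi_sigma_additive cons_measure.
Proof.
by apply: measure_semi_sigma_additive; exact: measurable_tuple_cons.
Qed.

HB.instance Definition _ := isMeasure.Build _ _ _ cons_measure
  cons_measure0 cons_measure_ge0 cons_measure_sigma_additive.

Let sigma_finite_cons_measure : sigma_finite setT cons_measure.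
Proof.
have /sigma_finiteP[F [TF ndF Foo]] := sigma_finiteT m1.
have /sigma_finiteP[G [TG ndG Goo]] := sigma_finiteT m2.
pose u (t : n.+1.-tuple T) : T * n.-tuple T :=
  (thead t, [tuple of behead t]).
have mu : measurable_fun setT u.
  by apply/measurable_fun_pair;
    [exact: measurable_tnth|exact: measurable_behead].
have uK p : u (tuple_cons p) = p.
  by case: p => a t; rewrite /u /tuple_cons theadE; congr pair; exact: val_inj.
exists (fun i => u @^-1` (F i `*` G i)).
  apply/esym; rewrite -subTset => t _.
  have : [set: T] (u t).1 by []. rewrite TF => -[i _ Fi].
  have : [set: n.-tuple T] (u t).2 by []. rewrite TG => -[j _ Gj].
  exists (maxn i j) => //; split => /=.
    by move: Fi; exact/subsetPset/ndF/leq_maxl.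
  by move: Gj; exact/subsetPset/ndG/leq_maxr.
move=> i; have [mF F_oo] := Foo i; have [mG G_oo] := Goo i; split.
  by rewrite -[X in measurable X]setTI; apply: mu => //; exact: measurableX.
rewrite /cons_measure /pushforward -comp_preimage.
rewrite (_ : u \o tuple_cons = id); last exact/funext.
by rewrite product_measure1E// lte_mul_pinfty// ge0_fin_numE.
Qed.

HB.instance Definition _ := Measure_isSigmaFinite.Build _ _ _ cons_measure
  sigma_finite_cons_measure.

End cons_measure.

(* Lebesgue measure on R^n: the unit mass at the empty tuple for n = 0, and the
   image of the product measure on R * R^n under (x, t) |-> x :: t for n.+1. *)
Fixpoint lebesgue_tuple {R : realType} (n : nat) :
    {sigma_finite_measure set (rtuple R n) -> \bar R} :=
  match n with
  | 0 => \d_([tuple] : rtuple R 0)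
  | n'.+1 => cons_measure (@lebesgue_measure R) (lebesgue_tuple n')
  end.

(* f is a p.d.f. on the region D of the random vector X.  In R[i], 0 <= z means
   that z is real and nonnegative, so that complex.Re (f x) is then f x itself. *)
Definition is_joint_pdf {d} {Omega : measurableType d} {R : realType}
    (P : probability Omega R) n (X : Omega -> rtuple R n)
    (D : set (rtuple R n)) (f : rtuple R n -> R[i]) : Prop :=
  [/\ forall x, D x -> 0 <= f x,
      measurable_fun D (fun x => complex.Re (f x)) &
      forall B, measurable B ->
        P (X @^-1` B) =
        (\int[lebesgue_tuple n]_(x in B `&` D) (complex.Re (f x))%:E)%E].

Section uniform_permutation.
Context {d} {Omega : measurableType d} {R : realType}.
Context (P : probability Omega R) (M : nat).

Definition uniform_perm (sigma : Omega -> 'S_M) : Prop :=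
  forall s : 'S_M, measurable (sigma @^-1` [set s]) /\
    P (sigma @^-1` [set s]) = ((M`!%:R : R)^-1)%:E.

Definition perm_independent n (sigma : Omega -> 'S_M)
    (X : Omega -> rtuple R n) : Prop :=
  forall (s : 'S_M) (B : set (rtuple R n)), measurable B ->
    P ((sigma @^-1` [set s]) `&` (X @^-1` B)) =
    (P (sigma @^-1` [set s]) * P (X @^-1` B))%E.

Definition random_vector (lambda : 'I_M -> {RV P >-> R}) (w : Omega) :
    rtuple R M :=
  [tuple lambda i w | i < M].

Definition unordered (lambda : 'I_M -> {RV P >-> R}) (sigma : Omega -> 'S_M)
    (w : Omega) : rtuple R M :=
  [tuple lambda (sigma w i) w | i < M].

Definition subvector n (iota : 'I_n -> 'I_M) (x : rtuple R M) : rtuple R n :=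
  [tuple tnth x (iota i) | i < n].

End uniform_permutation.

Section regions.
Context {R : realType} (alpha beta : \bar R).

Definition segment : set R := [set t | (alpha <= t%:E <= beta)%E].

Definition box n : set (rtuple R n) := [set x | forall i, segment (tnth x i)].

Definition ordered_region n : set (rtuple R n) :=
  [set x | box x /\ forall i j : 'I_n, (i <= j)%N -> tnth x j <= tnth x i].

Definition Cintegrable (D : set R) (g : R -> R[i]) : Prop :=
  (@lebesgue_measure R).-integrable D (fun t => (complex.Re (g t))%:E) /\
  (@lebesgue_measure R).-integrable D (fun t => (complex.Im (g t))%:E).

Definition Cintegral (D : set R) (g : R -> R[i]) : R[i] :=
  (\int[@lebesgue_measure R]_(t in D) complex.Re (g t))%R +i*
  (\int[@lebesgue_measure R]_(t in D) complex.Im (g t))%R.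

(* The integral over [alpha, beta] of g(x) w(x) dx, where the weight w is encoded
   by Some a for the Dirac delta(x - a) and by None for the constant 1. *)
Definition weighted_integral (w : option R) (g : R -> R[i]) : R[i] :=
  if w is Some a then g a else Cintegral segment g.

End regions.

Definition pseudo_det {K : comNzRingType} N (A : 'I_N -> 'I_N -> 'I_N -> K) : K :=
  \sum_(mu : 'S_N) (-1) ^+ mu *
    (\sum_(al : 'S_N) (-1) ^+ al * \prod_(k < N) A (mu k) (al k) k).

(* Indices start at 0.  For i : 'I_N, insub i : option 'I_M is Some of the same
   index if i < M and None otherwise. *)
Section model.
Context {R : realType} (M N : nat).
Context (Phi : 'I_M -> R -> R[i]) (Psi : 'I_N -> R -> R[i]).
Context (Psibar : 'I_N -> 'I_N -> R[i]) (xi : R -> R[i]).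

Definition Phi_mx (x : rtuple R M) : 'M[R[i]]_M :=
  \matrix_(i, j) Phi i (tnth x j).

Definition Psi_mx (x : rtuple R M) : 'M[R[i]]_N :=
  \matrix_(i, j)
    (if insub (j : nat) is Some j' then Psi i (tnth x j') else Psibar i j).

Definition ordered_density (K : R[i]) (x : rtuple R M) : R[i] :=
  K * \det (Phi_mx x) * \det (Psi_mx x) * \prod_(i < M) xi (tnth x i).

Definition varsigma (i : 'I_N) (t : R) : R[i] :=
  if insub (i : nat) is Some i' then Phi i' t * xi t else xi t.

Definition eta L (x : rtuple R L) (k : 'I_N) : option R :=
  if insub (k : nat) is Some k' then Some (tnth x k') else None.

Definition tensor (alpha beta : \bar R) L (x : rtuple R L) (i j k : 'I_N) :
    R[i] :=
  if (k < M)%N then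
    weighted_integral alpha beta (eta x k) (fun t => varsigma i t * Psi j t)
  else if (i < k)%N then 0 else Psibar j k.

End model.

(* Main.v *)
Require Import Defs.
From HB Require Import structures.
From mathcomp Require Import all_boot all_order all_fingroup all_algebra.
From mathcomp Require Import complex.
From mathcomp Require Import all_classical all_reals all_analysis.
From mathcomp Require Import measurable_realfun.

Set Implicit Arguments.
Unset Strict Implicit.
Unset Printing Implicit Defensive.
Import Order.TTheory GRing.Theory Num.Theory.
Import numFieldNormedType.Exports.

Local Open Scope classical_set_scope.
Local Open Scope ring_scope.
Local Open Scope complex_scope.

(** Write T_n for the pseudo-determinant attached to the density of n
    unordered eigenvalues, seen as a function of n points.  Four facts give the
    result.

    - A tensor whose entries factor as v_{i,k} w_{j,k} has pseudo-determinant
      det v * det w ([pseudo_det_mul]).  For n = M the tensor factors in this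
      way: w is the matrix Psi, and v is block lower triangular with diagonal
      blocks (Phi_i(x_k) xi(x_k)) and a lower unitriangular matrix.  That is why
      K T_M is the given ordered density ([tensor_det_full]).

    - Permuting the slices of a tensor along its last index multiplies the
      signs of both permutations in the pseudo-determinant by the same sign, so
      T_n is a symmetric function ([tensor_det_perm]).

    - The pseudo-determinant is linear in each slice, and in T_n the slice n,
      indices starting at 0, holds the integrals of the functions whose values at t it holds in
      T_{n+1}(x, t).  Hence T_n(x) is the integral of T_{n+1}(t, x) over t
      ([tensor_det_cons]).  Going down from n = M to n = L with Tonelli's
      theorem, this transports nonnegativity and measurability from K T_M to
      K T_L, and shows that integrating K T_M over M - L of its variables
      yields K T_L ([marginal_pos_measurable], [integral_marginal]).

    - Averaging over the random permutation turns the law of the unordered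
      vector into 1/M! times a sum over all permutations of integrals of the
      ordered density over permuted copies of the ordered region.  Lebesgue
      measure is invariant under permutations of coordinates
      ([lebesgue_tuple_perm]), and these copies tile the box, with overlaps only
      where two coordinates coincide, where det Phi, hence the density,
      vanishes ([sum_orderings]).  So the sum is the integral of K T_M over the
      box. *)

(** * Algebra of the pseudo-determinant *)

(** Reindexing both permutations by [s] moves [s] from the slices to
    them, and multiplies the two signs by the same sign. *)
Lemma pseudo_det_perm_slices (K : comNzRingType) N (s : 'S_N)
    (A : 'I_N -> 'I_N -> 'I_N -> K) :
  pseudo_det (fun i j k => A i j (s k)) = pseudo_det A.
Proof.
rewrite /pseudo_det (reindex_inj (mulgI s)); apply: eq_bigr => mu _.
rewrite (reindex_inj (mulgI s)) !mulr_sumr; apply: eq_bigr => al _.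
rewrite [in RHS](reindex_inj (@perm_inj _ s)) /=.
under eq_bigr do rewrite !permM.
by rewrite !mulrA -!signr_addb !odd_permM addbACA addbb.
Qed.

(** The product over [k] splits into a Leibniz term of [V] and one of
    [W]. *)
Lemma pseudo_det_mul (K : comNzRingType) N (V W : 'M[K]_N) :
  pseudo_det (fun i j k => V i k * W j k) = \det V * \det W.
Proof.
rewrite -[\det V]det_tr -[\det W]det_tr /pseudo_det /determinant mulr_suml.
apply: eq_bigr => mu _; rewrite -mulrA; congr (_ * _); rewrite mulr_sumr.
apply: eq_bigr => al _; rewrite mulrCA -big_split; congr (_ * _).
by apply: eq_bigr => k _; rewrite !mxE.
Qed.

(** Permuting the points x_1, ..., x_n permutes the first n slices of the
    tensor; as a permutation of all the slices it has to fix the others. *)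
Section extend_permutation.
Context (n N : nat) (leN : (n <= N)%N) (s : 'S_n).

Let ext (k : 'I_N) : 'I_N :=
  if insub (k : nat) is Some k' then widen_ord leN (s k') else k.

Let ext_inj : injective ext.
Proof.
move=> j k; rewrite /ext; case: insubP => [j' _ j'E|jn];
  case: insubP => [k' _ k'E|kn].
- move=> /(congr1 val)/= /val_inj/perm_inj e; apply: val_inj.
  by rewrite /= -[LHS]j'E -[RHS]k'E e.
- by move=> e; move: kn; rewrite -e /= ltn_ord.
- by move=> e; move: jn; rewrite e /= ltn_ord.
- by [].
Qed.

Definition extend_perm : 'S_N := perm ext_inj.

Lemma insub_extend_perm (k : 'I_N) :
  insub (extend_perm k : nat) = omap s (insub (k : nat) : option 'I_n).
Proof.
rewrite permE /ext; case: (insubP 'I_n (k : nat)) => [k' kn k'E|kn] /=.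
  by rewrite insubT; [exact: ltn_ord|move=> h; congr Some; exact: val_inj].
by rewrite insubF //; exact: negbTE.
Qed.

Lemma extend_perm_id (k : 'I_N) : (n <= k)%N -> extend_perm k = k.
Proof. by move=> nk; rewrite permE /ext insubF // ltnNge nk. Qed.

Lemma ltn_extend_perm (k : 'I_N) m :
  (n <= m)%N -> (extend_perm k < m)%N = (k < m)%N.
Proof.
move=> nm; have [kn|nk] := ltnP k n; last by rewrite extend_perm_id.
by rewrite (leq_trans kn) // permE /ext insubT /= (leq_trans _ nm).
Qed.

End extend_permutation.

Section tensor.
Context {R : realType} (M N : nat) (hMN : (M <= N)%N).
Context (Phi : 'I_M -> R -> R[i]) (Psi : 'I_N -> R -> R[i]).
Context (Psibar : 'I_N -> 'I_N -> R[i]) (xi : R -> R[i]).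
Context (alpha beta : \bar R).

Definition tensor_det n (x : rtuple R n) : R[i] :=
  pseudo_det (tensor Phi Psi Psibar xi alpha beta x).

Lemma tensor_det_perm n (s : 'S_n) (x : rtuple R n) : (n <= M)%N ->
  tensor_det (subvector s x) = tensor_det x.
Proof.
move=> nM; rewrite /tensor_det.
rewrite -[RHS](pseudo_det_perm_slices (extend_perm (leq_trans nM hMN) s)).
congr pseudo_det; apply/funext => i; apply/funext => j; apply/funext => k.
rewrite /tensor ltn_extend_perm //; case: ltnP => [_|Mk]; last first.
  by rewrite extend_perm_id // (leq_trans nM).
congr weighted_integral; rewrite /Defs.eta insub_extend_perm.
by case: insub => //= k'; rewrite tnth_mktuple.
Qed.

(** The form of the symmetry that also compares two ways of inserting a new
    point, such as [rcons] and [cons]. *)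
Lemma tensor_det_perm_eq n (x y : rtuple R n) : (n <= M)%N ->
  perm_eq x y -> tensor_det x = tensor_det y.
Proof.
move=> nM /tuple_permP[s xE]; rewrite -(tensor_det_perm s y nM).
congr tensor_det; apply: val_inj; exact: xE.
Qed.

End tensor.

(** With all M variables fixed no entry is an integral and the tensor
    factors.  For k >= M the factor (k <= i) accounts for the vanishing entries
    with i < k. *)
Lemma tensor_det_full (R : realType) (M N : nat) (Phi : 'I_M -> R -> R[i])
    (Psi : 'I_N -> R -> R[i]) (Psibar : 'I_N -> 'I_N -> R[i])
    (xi : R -> R[i]) (alpha beta : \bar R) (K : R[i]) (x : rtuple R M) :
  (M <= N)%N -> K * tensor_det Phi Psi Psibar xi alpha beta x =
  ordered_density Phi Psi Psibar xi K x.
Proof.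
move=> hMN.
(* Writing N as M + q makes the block decomposition of V available. *)
have [q NE] : exists q, N = (M + q)%N by exists (N - M)%N; rewrite subnKC.
subst N.
(* The matrix v of the factorization; the other factor is Psi_mx. *)
pose V : 'M[R[i]]_(M + q) := \matrix_(i, k)
  (if insub (k : nat) is Some k' then varsigma Phi xi i (tnth x k')
   else (k <= i)%:R).
have -> : tensor_det Phi Psi Psibar xi alpha beta x =
    \det V * \det (Psi_mx Psi Psibar x).
  rewrite -pseudo_det_mul; congr pseudo_det.
  apply/funext => i; apply/funext => j; apply/funext => k.
  rewrite /tensor /Defs.eta !mxE; case: insubP => [k' -> _//|/negbTE->].
  by rewrite ltnNge; case: (k <= i)%N; rewrite ?mul1r ?mul0r.
have VE : V = block_mx (Phi_mx Phi x *m diag_mx (\row_k xi (tnth x k))) 0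
                 (dlsubmx V) (drsubmx V).
  rewrite -[LHS]submxK mul_mx_diag; congr block_mx; apply/matrixP => i k;
    rewrite !mxE /=.
    by rewrite (valK k : insub (k : nat) = Some k) /varsigma /=
      (valK i : insub (i : nat) = Some i).
  rewrite insubF; last by rewrite ltnNge leq_addr.
  by rewrite leqNgt (leq_trans (ltn_ord i)) ?leq_addr.
have dr k j : drsubmx V k j = (j <= k)%:R.
  rewrite !mxE insubF /=; last by rewrite ltnNge leq_addr.
  by rewrite leq_add2l.
have -> : \det V = \det (Phi_mx Phi x) * \prod_(i < M) xi (tnth x i).
  rewrite VE det_lblock det_mulmx det_diag; under eq_bigr do rewrite mxE.
  rewrite [X in _ * X]det_trig; last first.
    by apply/is_trig_mxP => i j ij; rewrite dr leqNgt ij.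
  by rewrite [X in _ * X]big1 ?mulr1 // => i _; rewrite dr leqnn.
rewrite /ordered_density -!mulrA; congr (_ * (_ * _)); exact: mulrC.
Qed.

Lemma ordered_density_tie (R : realType) (M N : nat) (Phi : 'I_M -> R -> R[i])
    (Psi : 'I_N -> R -> R[i]) (Psibar : 'I_N -> 'I_N -> R[i])
    (xi : R -> R[i]) (K : R[i]) (x : rtuple R M) :
  ~~ uniq x -> ordered_density Phi Psi Psibar xi K x = 0.
Proof.
move=> /(uniqPn 0)[i [j [ij jx e]]]; rewrite size_tuple in jx.
have iM := ltn_trans ij jx.
rewrite /ordered_density (_ : \det (Phi_mx Phi x) = 0) ?mulr0 ?mul0r//.
rewrite -det_tr.
apply: (@determinant_alternate _ _ _ (Ordinal iM) (Ordinal jx)).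
  by rewrite -val_eqE /= ltn_eqF.
by move=> k; rewrite !mxE !(tnth_nth 0) e.
Qed.

(** * Integrating out one variable of the pseudo-determinant *)

(** The integral of a complex function being defined through its real and
    imaginary parts, its linearity over the complex numbers has to be recovered
    from that of the real integral; integrability is carried along. *)
Section complex_integral.
Context {R : realType} (D : set R) (mD : measurable (D : set (measurableTypeR R))).

Lemma CintegrableZl (c : R[i]) (g : R -> R[i]) : Cintegrable D g ->
  Cintegrable D (fun t => c * g t) /\
  Cintegral D (fun t => c * g t) = c * Cintegral D g.
Proof.
case: c => a b [iRe iIm].
have ReE t : complex.Re ((a +i* b) * g t) =
    a * complex.Re (g t) + (- b) * complex.Im (g t).
  by case: (g t) => u v /=; rewrite mulNr.
have ImE t : complex.Im ((a +i* b) * g t) =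
    a * complex.Im (g t) + b * complex.Re (g t).
  by case: (g t) => u v.
have iZ (e : R) (h : R -> R) :
    (@lebesgue_measure R).-integrable D (fun t => (h t)%:E) ->
    (@lebesgue_measure R).-integrable D (fun t => (e * h t)%:E).
  by move=> ih; under eq_fun do rewrite EFinM; exact: integrableZl.
split; first split.
- under eq_fun do rewrite ReE EFinD.
  by apply: integrableD => //; exact: iZ.
- under eq_fun do rewrite ImE EFinD.
  by apply: integrableD => //; exact: iZ.
- rewrite /Cintegral; under eq_Rintegral do rewrite ReE.
  under [in X in _ +i* X]eq_Rintegral do rewrite ImE.
  rewrite !RintegralD ?RintegralZl //; try exact: iZ.
  by apply/eqP; rewrite eq_complex /= mulNr !eqxx.
Qed.

Lemma CintegrableD (f g : R -> R[i]) : Cintegrable D f -> Cintegrable D g ->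
  Cintegrable D (fun t => f t + g t) /\
  Cintegral D (fun t => f t + g t) = Cintegral D f + Cintegral D g.
Proof.
move=> [fRe fIm] [gRe gIm].
have ReE t : complex.Re (f t + g t) = complex.Re (f t) + complex.Re (g t).
  by case: (f t) (g t) => ? ? [].
have ImE t : complex.Im (f t + g t) = complex.Im (f t) + complex.Im (g t).
  by case: (f t) (g t) => ? ? [].
split; first split.
- by under eq_fun do rewrite ReE EFinD; exact: integrableD.
- by under eq_fun do rewrite ImE EFinD; exact: integrableD.
- rewrite /Cintegral; under eq_Rintegral do rewrite ReE.
  under [in X in _ +i* X]eq_Rintegral do rewrite ImE.
  by rewrite !RintegralD.
Qed.

Lemma Cintegrable_lincomb (I : Type) (r : seq I) (c : I -> R[i])
    (g : I -> R -> R[i]) : (forall i, Cintegrable D (g i)) ->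
  Cintegrable D (fun t => \sum_(i <- r) c i * g i t) /\
  Cintegral D (fun t => \sum_(i <- r) c i * g i t) =
  \sum_(i <- r) c i * Cintegral D (g i).
Proof.
move=> ig; elim: r => [|i r [ih IH]].
  under eq_fun do rewrite big_nil; rewrite big_nil; split.
    by split; exact: integrable0.
  by rewrite /Cintegral /= /Rintegral integral0.
have [iZ ZE] := CintegrableZl (c i) (ig i).
have [iD DE] := CintegrableD iZ ih.
under eq_fun do rewrite big_cons; rewrite big_cons.
by split=> //; rewrite DE ZE IH.
Qed.

End complex_integral.

Lemma measurable_segment (R : realType) (alpha beta : \bar R) :
  measurable (segment alpha beta : set (measurableTypeR R)).
Proof.
rewrite (_ : segment _ _ = EFin @^-1` `[alpha, beta]); last first.
  by apply/seteqP; split=> t; rewrite /= in_itv.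
rewrite -[X in measurable X]setTI; apply: EFin_measurable => //.
exact: emeasurable_itv.
Qed.

(** Isolating the factor from the slice [k0] displays the pseudo-determinant as
    a linear combination of the entries of that slice, with coefficients
    that depend on the other slices only. *)
Lemma pseudo_det_slice (K : comNzRingType) N (k0 : 'I_N)
    (A : 'I_N -> 'I_N -> 'I_N -> K) :
  pseudo_det A = \sum_(p : 'S_N * 'S_N)
    ((-1) ^+ p.1 * (-1) ^+ p.2 * \prod_(k | k != k0) A (p.1 k) (p.2 k) k) *
    A (p.1 k0) (p.2 k0) k0.
Proof.
rewrite -(pair_bigA _ (fun mu al : 'S_N => ((-1) ^+ mu * (-1) ^+ al *
  \prod_(k | k != k0) A (mu k) (al k) k) * A (mu k0) (al k0) k0)) /=.
apply: eq_bigr => mu _; rewrite mulr_sumr; apply: eq_bigr => al _.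
by rewrite (bigD1 k0) //= !mulrA mulrAC.
Qed.

Section integrate_out.
Context {R : realType} (M N : nat) (hMN : (M <= N)%N).
Context (Phi : 'I_M -> R -> R[i]) (Psi : 'I_N -> R -> R[i]).
Context (Psibar : 'I_N -> 'I_N -> R[i]) (xi : R -> R[i]).
Context (alpha beta : \bar R).
Let T n (x : rtuple R n) := tensor_det Phi Psi Psibar xi alpha beta x.

(** The tensors of (t, x) and of x differ, up to the order of the points, in the
    slice n alone: there the entry of the second is the integral over t of the
    entry of the first, and the pseudo-determinant is linear in that slice. *)
Lemma tensor_det_cons n (x : rtuple R n) : (n < M)%N ->
  (forall i j : 'I_N, Cintegrable (segment alpha beta)
     (fun t => varsigma Phi xi i t * Psi j t)) ->
  Cintegrable (segment alpha beta) (fun t => T (tuple_cons (t, x))) /\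
  Cintegral (segment alpha beta) (fun t => T (tuple_cons (t, x))) = T x.
Proof.
move=> nM int.
pose A := tensor Phi Psi Psibar xi alpha beta x.
pose k0 := Ordinal (leq_trans nM hMN).
pose c (p : 'S_N * 'S_N) := (-1) ^+ p.1 * (-1) ^+ p.2 *
  \prod_(k | k != k0) A (p.1 k) (p.2 k) k.
(* By symmetry t may be put last, which makes it the point that belongs to the
   slice n and leaves the other slices of the tensor of x unchanged. *)
have consE t : T (tuple_cons (t, x)) =
    \sum_p c p * (varsigma Phi xi (p.1 k0) t * Psi (p.2 k0) t).
  rewrite /T (tensor_det_perm_eq hMN Phi Psi Psibar xi alpha beta nM
    (y := [tuple of rcons x t])); last by rewrite perm_sym perm_rcons.
  rewrite /tensor_det (pseudo_det_slice k0); apply: eq_bigr => p _.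
  congr (_ * _ * _).
    apply: eq_bigr => k kk0; rewrite /A /tensor.
    congr (if _ then weighted_integral _ _ _ _ else _).
    rewrite /Defs.eta; case: (ltngtP k n) => [kn|nk|kn].
    - rewrite !insubT; first by rewrite ltnS ltnW.
      move=> kn'; congr Some; rewrite !(tnth_nth 0) /= nth_rcons size_tuple.
      by rewrite kn.
    - by rewrite !insubF // ltnNge ?nk// ltnW.
    - by move: kk0; rewrite -val_eqE /= kn eqxx.
  rewrite /tensor /= nM /Defs.eta. rewrite insubT => [|h] /=; first exact: ltnSn.
  by rewrite (tnth_nth 0) /= nth_rcons size_tuple ltnn eqxx.
have TE : T x = \sum_p c p * Cintegral (segment alpha beta)
    (fun t => varsigma Phi xi (p.1 k0) t * Psi (p.2 k0) t).
  rewrite /T /tensor_det (pseudo_det_slice k0); apply: eq_bigr => p _.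
  by rewrite {2}/tensor /= nM /Defs.eta insubF ?ltnn.
under eq_fun do rewrite consE; rewrite TE.
by apply: Cintegrable_lincomb => //; exact: measurable_segment.
Qed.

End integrate_out.

(** * Lebesgue measure on tuples: symmetry and iterated integration *)

Section lebesgue_tuple_theory.
Context {R : realType}.

Definition rectangle n (A : 'I_n -> set (measurableTypeR R)) :
    set (rtuple R n) := [set x | forall i, A i (tnth x i)].

Lemma measurable_rectangle n (A : 'I_n -> set (measurableTypeR R)) :
  (forall i, measurable (A i)) -> measurable (rectangle A).
Proof.
move=> mA; rewrite (_ : rectangle A =
    \big[setI/setT]_(i < n) ((@tnth _ _ ^~ i) @^-1` A i)).
  apply: bigsetI_measurable => i _; rewrite -[X in measurable X]setTI.
  exact: measurable_tnth.
rewrite -bigcap_seq; apply/seteqP; split=> x /= Ax i; last first.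
  by apply: Ax => /=; rewrite mem_index_enum.
by move=> _; exact: Ax.
Qed.

Lemma measurable_subvector m n (s : 'I_m -> 'I_n) :
  measurable_fun [set: rtuple R n] (subvector (R := R) s).
Proof.
apply/measurable_fun_tnthP => i.
rewrite (_ : _ \o _ = fun x => tnth x (s i)); first exact: measurable_tnth.
by apply/funext => x /=; rewrite tnth_mktuple.
Qed.

Lemma measurable_preimage_subvector m n (s : 'I_m -> 'I_n)
    (B : set (rtuple R m)) :
  measurable B -> measurable (subvector (R := R) s @^-1` B).
Proof.
by move=> mB; rewrite -[X in measurable X]setTI; apply: measurable_subvector.
Qed.

Lemma lebesgue_tuple_rectangle n (A : 'I_n -> set (measurableTypeR R)) :
  (forall i, measurable (A i)) ->
  lebesgue_tuple n (rectangle A) = (\prod_(i < n) @lebesgue_measure R (A i))%E.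
Proof.
elim: n A => [|n ih] A mA.
  rewrite big_ord0 /= diracE mem_set//; by case.
rewrite big_ord_recl -ih // /= /cons_measure /pushforward.
rewrite (_ : tuple_cons (n:=n) @^-1` rectangle A =
    A ord0 `*` rectangle (fun i => A (lift ord0 i))).
  by rewrite product_measure1E //; exact: measurable_rectangle.
apply/seteqP; split=> -[a x] /=.
  move=> h; split; first by have := h ord0.
  by move=> i; have := h (lift ord0 i); rewrite /tuple_cons /= tnthS.
move=> [Aa Ax] i; case: (unliftP ord0 i) => [j ->|->] //=.
by rewrite /tuple_cons tnthS; exact: Ax.
Qed.

(** Both sides are measures that agree on rectangles, since the measure of a
    rectangle is the product of the lengths of its sides; rectangles generate
    the product sigma-algebra and those with sides of finite measure exhaust the
    space. *)
Lemma lebesgue_tuple_perm n (s : 'S_n) (B : set (rtuple R n)) :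
  measurable B ->
  lebesgue_tuple n (subvector (R := R) s @^-1` B) = lebesgue_tuple n B.
Proof.
have [F [TF ndF Foo]] :=
  (sigma_finiteP _ _).1 (sigma_finiteT (@lebesgue_measure R)).
have mF k : measurable (F k : set (measurableTypeR R)) by case: (Foo k).
pose G := [set C : set (rtuple R n) | exists2 A : 'I_n -> set (measurableTypeR R),
  forall i, measurable (A i) & C = rectangle A].
pose g k := rectangle (fun _ : 'I_n => F k).
(* As the measurability of the map is left open, push is a function of its
   proof. *)
pose push := (pushforward (lebesgue_tuple n) (subvector (R := R) s) :
  {measure set (rtuple R n) -> \bar R}).
pose m2 := push (measurable_subvector s).
move=> mB; apply/esym; suff : lebesgue_tuple n B = m2 B by [].
move: B mB; apply: (measure_unique G g) => //=.
- apply/seteqP; split=> C; last first.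
    apply: smallest_sub; first exact: sigma_algebra_measurable.
    by move=> _ [A mA ->]; exact: measurable_rectangle.
  apply: smallest_sub; first exact: smallest_sigma_algebra.
  move=> D; rewrite -bigcup_seq => -[i _ [A mA <-]].
  apply: sub_sigma_algebra; exists (fun j => if j == i then A else setT).
    by move=> j; case: ifP.
  rewrite setTI; apply/seteqP; split=> x /=.
    by move=> Ax j; case: eqP => // ->.
  by move=> /(_ i); rewrite eqxx.
- move=> _ _ [A mA ->] [A' mA' ->]; exists (fun i => A i `&` A' i).
    by move=> i; exact: measurableI.
  apply/seteqP; split=> x /=; first by move=> [h1 h2] i; split.
  by move=> h; split=> i; case: (h i).
- by move=> k; exists (fun=> F k).
- apply/seteqP; split=> // x _.
  have /choice[k Fk] : forall i, exists k, F k (tnth x i).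
    move=> i; have : [set: R] (tnth x i) by [].
    by rewrite TF => -[k _ Fk]; exists k.
  exists (\max_(i < n) k i)%N => // i.
  by move: (Fk i); apply/subsetPset/ndF/leq_bigmax.
- move=> _ [A mA ->]; rewrite lebesgue_tuple_rectangle // /pushforward.
  rewrite (_ : _ @^-1` _ = rectangle (fun i => A ((s^-1)%g i))).
    rewrite lebesgue_tuple_rectangle // [in LHS](reindex_inj (@perm_inj _ (s^-1)%g)).
    by [].
  apply/seteqP; split=> x /= h i.
    by have := h ((s^-1)%g i); rewrite tnth_mktuple permKV.
  by have := h (s i); rewrite tnth_mktuple permK.
- move=> k; rewrite lebesgue_tuple_rectangle //.
  suff : (\prod_(i < n) @lebesgue_measure R (F k))%E \is a fin_num.
    by move=> /fineK <-; exact: ltry.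
  apply: (big_ind (fun z => z \is a fin_num)) => // [x y|i _].
    exact: fin_numM.
  by rewrite ge0_fin_numE //; case: (Foo k).
Qed.

Lemma ge0_integral_lebesgue_tuple_perm n (s : 'S_n) (D : set (rtuple R n))
    (f : rtuple R n -> \bar R) :
  measurable D -> measurable_fun D f -> (forall x, D x -> (0 <= f x)%E) ->
  (\int[lebesgue_tuple n]_(x in D) f x =
   \int[lebesgue_tuple n]_(x in subvector (R := R) s @^-1` D)
     f (subvector (R := R) s x))%E.
Proof.
move=> mD mf f0.
rewrite -[RHS](ge0_integral_pushforward (measurable_subvector s)
  (lebesgue_tuple n)) // => [|x /set_mem]; last exact: f0.
apply: eq_measure_integral => [|ms A mA _]; first exact: measurable_subvector.
exact: esym (lebesgue_tuple_perm s mA).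
Qed.

(** Tonelli for the recursive construction of the measure, on a set that does
    not restrict the first coordinate. *)
Lemma ge0_integral_lebesgue_tuple_cons n (B : set (rtuple R n))
    (f : rtuple R n.+1 -> \bar R) :
  measurable B -> measurable_fun setT f -> (forall x, (0 <= f x)%E) ->
  measurable_fun setT
    (fun x => \int[@lebesgue_measure R]_t f (tuple_cons (t, x)))%E /\
  (\int[lebesgue_tuple n.+1]_(z in
      (fun z : rtuple R n.+1 => [tuple of behead z]) @^-1` B) f z =
   \int[lebesgue_tuple n]_(x in B)
     \int[@lebesgue_measure R]_t f (tuple_cons (t, x)))%E.
Proof.
move=> mB mf f0.
have mfcons : measurable_fun setT (f \o @tuple_cons _ (measurableTypeR R) n).
  by apply: measurableT_comp => //; exact: measurable_tuple_cons.
split.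
  exact: (measurable_fun_fubini_tonelli_G (m1 := @lebesgue_measure R)
    (f \o @tuple_cons _ (measurableTypeR R) n) mfcons (fun p => f0 _)).
pose B' := (fun z : rtuple R n.+1 => [tuple of behead z]) @^-1` B.
have mB' : measurable B'.
  rewrite -[B']setTI.
  exact: (@measurable_behead _ (measurableTypeR R) n measurableT B mB).
have mfB : measurable_fun setT (f \_ B').
  apply/(measurable_restrictT f mB'). exact: measurable_funTS.
have fB0 z : (0 <= (f \_ B') z)%E by rewrite /patch; case: ifP.
rewrite -/B' integral_mkcond [RHS]integral_mkcond.
transitivity (\int[lebesgue_measure \x lebesgue_tuple n]_p
    (f \_ B') (tuple_cons p))%E.
  rewrite -[RHS](ge0_integral_pushforward (@measurable_tuple_cons _ _ n)
    (lebesgue_measure \x lebesgue_tuple n)%E (D := setT)) //.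
rewrite fubini_tonelli2 //; last first.
  by apply: measurableT_comp => //; exact: measurable_tuple_cons.
apply: eq_integral => x _; rewrite /fubini_G [RHS]/patch; case: ifPn => xB.
  apply: eq_integral => t _; rewrite /patch ifT // inE /B' /=.
  by move: xB; rewrite inE; congr B; apply: val_inj.
apply: integral0_eq => t _; rewrite /patch ifF //; apply: contraNF xB.
by rewrite !inE /B' /=; congr B; apply: val_inj.
Qed.
End lebesgue_tuple_theory.

(** * Tiling the box by the orderings of a point *)

Section reordering.
Context {R : realType} (alpha beta : \bar R).

Lemma measurable_box n : measurable (box alpha beta (n:=n)).
Proof.
apply: (measurable_rectangle (A := fun=> segment alpha beta)) => _.
exact: measurable_segment.
Qed.

Lemma measurable_ordered_region n :
  measurable (ordered_region alpha beta (n:=n)).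
Proof.
rewrite (_ : ordered_region _ _ (n:=n) = box alpha beta (n:=n) `&`
    \big[setI/setT]_(p : 'I_n * 'I_n | (p.1 <= p.2)%N)
      [set x : rtuple R n | tnth x p.2 <= tnth x p.1]).
  apply: measurableI; first exact: measurable_box.
  apply: bigsetI_measurable => p _; rewrite -[X in measurable X]setTI.
  by apply: measurable_fun_le => //; exact: measurable_tnth.
apply/seteqP; split=> x [xbox xord]; split=> //.
  rewrite -bigcap_seq_cond => p /= /andP[_ p12]; exact: xord.
move=> i j ij; move: xord; rewrite -bigcap_seq_cond => /(_ (i, j)) /= xij.
by apply: xij; rewrite /= mem_index_enum.
Qed.

Lemma subvector_comp a b c (s : 'I_a -> 'I_b) (t : 'I_b -> 'I_c)
    (x : rtuple R c) : subvector s (subvector t x) = subvector (t \o s) x.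
Proof. by apply: eq_from_tnth => i; rewrite !tnth_mktuple. Qed.

Lemma subvector_permK n (s : 'S_n) (x : rtuple R n) :
  subvector s (subvector (s^-1)%g x) = x.
Proof. by apply: eq_from_tnth => i; rewrite !tnth_mktuple permK. Qed.

Lemma box_subvector_perm n (s : 'S_n) (x : rtuple R n) :
  box alpha beta (subvector s x) <-> box alpha beta x.
Proof.
split=> xb i; last by rewrite tnth_mktuple.
by have := xb ((s^-1)%g i); rewrite tnth_mktuple permKV.
Qed.

(** The permutation is the one that sorts [x] in decreasing order. *)
Lemma exists_ordering n (x : rtuple R n) : box alpha beta x ->
  exists s : 'S_n, ordered_region alpha beta (subvector s x).
Proof.
move=> xb; have /permPl pxs := perm_sort (fun a b : R => b <= a) x.
have szs : size (sort (fun a b : R => b <= a) x) == n.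
  by rewrite size_sort size_tuple.
have /tuple_permP[s sE] : perm_eq (Tuple szs) x by [].
exists s; split; first exact/box_subvector_perm.
move=> i j ij; rewrite !(tnth_nth 0) /= -sE.
apply: (sorted_leq_nth (leT := fun a b : R => b <= a)) => //.
- by move=> a b c ba cb; exact: le_trans cb ba.
- by apply: sort_sorted => a b; exact: ge_total.
- by rewrite inE size_tuple.
- by rewrite inE size_tuple.
Qed.

(** Two sorted rearrangements of [x] are equal as sequences; when the
    entries of [x] are distinct, this forces the permutations to be equal. *)
Lemma ordering_unique n (x : rtuple R n) (s s' : 'S_n) : uniq x ->
  ordered_region alpha beta (subvector s x) ->
  ordered_region alpha beta (subvector s' x) -> s = s'.
Proof.
move=> /tuple_uniqP xinj [_ os] [_ os'].
have sorted_ordered (y : rtuple R n) :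
    (forall i j : 'I_n, (i <= j)%N -> tnth y j <= tnth y i) ->
    sorted (fun a b : R => b <= a) y.
  move=> oy; apply/(sortedP 0) => i; rewrite size_tuple => iN.
  have := oy (Ordinal (ltnW iN)) (Ordinal iN) (leqnSn i).
  by rewrite !(tnth_nth 0).
have ss' : subvector s x = subvector s' x.
  apply: val_inj; apply: (sorted_eq (leT := fun a b : R => b <= a)).
  - by move=> a b c ba cb; exact: le_trans cb ba.
  - by move=> a b /andP[ba ab]; apply/le_anti; rewrite ab ba.
  - exact: sorted_ordered.
  - exact: sorted_ordered.
  have perm_sub (t : 'S_n) : perm_eq (subvector t x) x.
    by apply/tuple_permP; exists t.
  apply: (perm_trans (perm_sub s)); rewrite perm_sym; exact: perm_sub.
apply/permP => i; apply: xinj.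
by have := congr1 (fun y => tnth y i) ss'; rewrite !tnth_mktuple.
Qed.

(** The copies of the ordered region tile the box: a point with distinct
    coordinates lies in exactly one copy, and the others do not count since [g]
    vanishes there. *)
Lemma sum_orderings n (g : rtuple R n -> \bar R) (x : rtuple R n) :
  (forall (s : 'S_n) y, g (subvector s y) = g y) ->
  (forall y : rtuple R n, ~~ uniq y -> g y = 0%E) ->
  (\sum_(s : 'S_n) (g \_ (ordered_region alpha beta (n:=n))) (subvector s x) =
   (g \_ (box alpha beta (n:=n))) x)%E.
Proof.
move=> gperm gtie; rewrite [RHS]/patch; case: ifPn => [|xb]; last first.
  apply: big1 => s _; rewrite /patch ifF //; apply: contraNF xb.
  by rewrite !inE => -[] /box_subvector_perm.
rewrite inE => xb; have [s0 os0] := exists_ordering xb.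
rewrite (bigD1 s0) //= big1 ?adde0; first by rewrite /patch mem_set.
move=> s ss0; rewrite /patch; case: ifPn => //; rewrite inE gperm => os.
apply: gtie; apply: contraNN ss0 => ux; apply/eqP.
exact: ordering_unique ux os os0.
Qed.

End reordering.

(** * Marginals of the symmetric density *)

Section marginal.
Context {R : realType} (L M N : nat) (hMN : (M <= N)%N).
Context (Phi : 'I_M -> R -> R[i]) (Psi : 'I_N -> R -> R[i]).
Context (Psibar : 'I_N -> 'I_N -> R[i]) (xi : R -> R[i]).
Context (alpha beta : \bar R) (K : R[i]).

Let S := segment alpha beta.
Let T n (x : rtuple R n) := tensor_det Phi Psi Psibar xi alpha beta x.

(** Up to the factor 1/M!, the candidate for the joint density of n unordered
    eigenvalues, extended by 0 outside the box so that it can be integrated over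
    the whole space. *)
Definition marginal n : rtuple R n -> \bar R :=
  (fun x => (complex.Re (K * T x))%:E) \_ (box alpha beta (n:=n)).

Hypothesis int : forall n, (L <= n < M)%N -> forall i j : 'I_N,
  Cintegrable S (fun t => varsigma Phi xi i t * Psi j t).

Lemma box_cons n (t : R) (x : rtuple R n) :
  box alpha beta (tuple_cons ((t : measurableTypeR R), x)) <->
  S t /\ box alpha beta x.
Proof.
split=> [b|[St bx] i].
  split; first by have := b ord0.
  by move=> i; have := b (lift ord0 i); rewrite tnthS.
by case: (unliftP ord0 i) => [j ->|->] //; rewrite tnthS; exact: bx.
Qed.

(** Nonnegativity and the integral formula are proved together: K T_n(x) is the
    complex integral of a function with nonnegative real values, hence its
    imaginary part vanishes and its real part is the integral of the real
    part. *)
Lemma marginal_cons n (x : rtuple R n) : (L <= n < M)%N ->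
  (forall z : rtuple R n.+1, box alpha beta z -> 0 <= K * T z) ->
  (box alpha beta x -> 0 <= K * T x) /\
  marginal x = (\int[@lebesgue_measure R]_t marginal (tuple_cons (t, x)))%E.
Proof.
move=> LnM T_ge0; have /andP[_ nM] := LnM.
have [iT TE] := tensor_det_cons hMN Psibar x nM (int LnM).
have [[iRe _] ZE] := CintegrableZl (measurable_segment alpha beta) K iT.
rewrite /marginal [LHS]/patch; split=> [xb|].
  rewrite /T -TE -ZE lecE /=; apply/andP; split; last first.
    by apply: Rintegral_ge0 => t St; have := T_ge0 (tuple_cons (t, x));
      rewrite lecE => /(_ _)/andP[] //; exact/box_cons.
  rewrite (@eq_Rintegral _ _ _ _ _ (fun=> 0)) ?Rintegral_cst ?mul0r //.
    exact: measurable_segment.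
  move=> t /set_mem St; have := T_ge0 (tuple_cons (t, x)).
  by rewrite lecE => /(_ ((box_cons t x).2 (conj St xb))) /andP[/eqP].
case: ifPn => [/set_mem xb|xb]; last first.
  rewrite integral0_eq // => t _; rewrite /patch ifF //.
  by apply: contraNF xb; rewrite !inE => /box_cons[].
rewrite /T -TE -ZE /= /Rintegral fineK; last first.
  exact: (integrable_fin_num (measurable_segment alpha beta) iRe).
rewrite integral_mkcond; apply: eq_integral => t _; rewrite /patch.
case: ifPn => [/set_mem St|St]; first by rewrite mem_set //; exact/box_cons.
by rewrite ifF //; apply: contraNF St; rewrite !inE => /box_cons[].
Qed.

Hypothesis T_ge0 : forall z : rtuple R M, box alpha beta z -> 0 <= K * T z.
Hypothesis mT : measurable_fun setT (@marginal M).

Lemma marginal_ge0 n (x : rtuple R n) :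
  (forall z : rtuple R n, box alpha beta z -> 0 <= K * T z) ->
  (0 <= marginal x)%E.
Proof.
move=> T0; rewrite /marginal /patch; case: ifPn => // /set_mem /T0.
by rewrite lecE lee_fin => /andP[].
Qed.

(** Descending induction on n from M: each step is an integral of
    the previous function in one variable. *)
Lemma marginal_pos_measurable n : (L <= n <= M)%N ->
  (forall z : rtuple R n, box alpha beta z -> 0 <= K * T z) /\
  measurable_fun setT (@marginal n).
Proof.
move=> /andP[+ /subnKC]; move: (M - n)%N => j; elim: j n => [|j ih] n Ln.
  by rewrite addn0 => ->.
rewrite addnS -addSn => nM; have [T0 mn] := ih _ (leqW Ln) nM.
have nM' : (L <= n < M)%N by rewrite Ln -nM leq_addr.
split=> [x xb|]; first exact: (marginal_cons x nM' T0).1.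
rewrite (_ : @marginal n =
    fun x => (\int[@lebesgue_measure R]_t marginal (tuple_cons (t, x)))%E).
  exact: (ge0_integral_lebesgue_tuple_cons measurableT mn
    (fun z => marginal_ge0 z T0)).1.
by apply/funext => x; exact: (marginal_cons x nM' T0).2.
Qed.

(** The variables integrated out are the first m ones, because the measure is
    built by adding coordinates in front; [B] constrains the last L ones. *)
Lemma integral_marginal m (B : set (rtuple R L)) : (m + L <= M)%N ->
  measurable B ->
  (\int[lebesgue_tuple (m + L)]_(z in subvector (R := R) (@rshift m L) @^-1` B)
     marginal z = \int[lebesgue_tuple L]_(x in B) marginal x)%E.
Proof.
move=> mLM mB; elim: m mLM => [|m ih] mLM.
  congr (\int[_]_(z in _) _)%E; apply/seteqP; split=> x /=;
    congr B; apply: eq_from_tnth => i; rewrite tnth_mktuple;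
    congr tnth; exact: val_inj.
rewrite -ih ?(ltnW mLM) //.
have LmM : (L <= (m + L).+1 <= M)%N by rewrite leqW ?leq_addl.
have [T0 mn] := marginal_pos_measurable LmM.
rewrite (_ : subvector _ @^-1` B =
    (fun z : rtuple R (m + L).+1 => [tuple of behead z]) @^-1`
      (subvector (R := R) (@rshift m L) @^-1` B)).
  have [_ ->] := ge0_integral_lebesgue_tuple_cons
    (measurable_preimage_subvector (@rshift m L) mB) mn
    (fun x => marginal_ge0 x T0).
  by apply: eq_integral => x _; rewrite (marginal_cons x _ T0).2 // leq_addl.
suff e (z : rtuple R (m + L).+1) : subvector (@rshift m.+1 L) z =
    subvector (@rshift m L) [tuple of behead z].
  by apply/seteqP; split=> z /=; rewrite e.
by apply: eq_from_tnth => i; rewrite !tnth_mktuple !(tnth_nth 0) /= nth_behead.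
Qed.

End marginal.

(** * The law of the unordered eigenvalues *)

(** The permutation is read off the list of all indices outside the range of
    [iota] followed by the values of [iota].  It makes the chosen
    eigenvalues the last L ones, which fits [integral_marginal]. *)
Lemma extend_injection_perm m L (iota : 'I_L -> 'I_(m + L)) :
  injective iota -> exists p : 'S_(m + L), forall i, p (rshift m i) = iota i.
Proof.
move=> iota_inj.
pose t := [seq iota i | i <- enum 'I_L].
pose r := [seq j <- enum 'I_(m + L) | j \notin t].
have rtP : perm_eq (r ++ t) (ord_tuple (m + L)).
  apply: uniq_perm; last 2 first.
  - by rewrite val_ord_tuple enum_uniq.
  - move=> j; rewrite mem_cat mem_filter val_ord_tuple mem_enum inE andbT.
    by rewrite orNb.
  rewrite cat_uniq filter_uniq ?enum_uniq // map_inj_uniq ?enum_uniq // andbT.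
  by apply/hasPn => j jt; rewrite mem_filter jt.
have szt : size t = L by rewrite size_map size_enum_ord.
have szr : size r = m.
  by have := perm_size rtP; rewrite size_cat szt size_tuple => /addIn.
have /tuple_permP[p pE] := rtP; exists p => i.
have := congr1 (fun s => nth (iota i) s (rshift m i)) pE.
rewrite -[X in _ = X](tnth_nth _ _ (rshift m i)) tnth_mktuple tnth_ord_tuple => <-.
rewrite nth_cat szr ltnNge leq_addr /= addKn (nth_map i) ?size_enum_ord //.
by rewrite nth_ord_enum.
Qed.


Section unordered_law.
Context {d} {Omega : measurableType d} {R : realType}.
Context (P : probability Omega R) (M : nat).
Context (lambda : 'I_M -> {RV P >-> R}) (sigma : Omega -> 'S_M).

Lemma measurable_random_vector_preimage (C : set (rtuple R M)) :
  measurable C -> measurable (random_vector lambda @^-1` C).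
Proof.
suff mrv : measurable_fun setT (random_vector lambda).
  by move=> mC; rewrite -[X in measurable X]setTI; exact: mrv.
apply/measurable_fun_tnthP => i.
rewrite (_ : _ \o _ = (lambda i : Omega -> measurableTypeR R)).
  exact: (@measurable_funPT _ _ _ _ (lambda i)).
by apply: funext => w; rewrite /= tnth_mktuple.
Qed.

(** The total probability formula over the values of [sigma], which are
    equiprobable and independent of the ordered vector. *)
Lemma prob_subvector_unordered L (iota : 'I_L -> 'I_M) (B : set (rtuple R L)) :
  uniform_perm P sigma -> perm_independent P sigma (random_vector lambda) ->
  measurable B ->
  P ((fun w => subvector iota (unordered lambda sigma w)) @^-1` B) =
  (\sum_(s : 'S_M) ((M`!%:R)^-1)%:E *
     P (random_vector lambda @^-1` (subvector (R := R) (s \o iota) @^-1` B)))%E.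
Proof.
move=> hsigma hindep mB.
pose C (s : 'S_M) := subvector (R := R) (s \o iota) @^-1` B.
have mC s : measurable (C s) by exact: measurable_preimage_subvector.
pose E s := (sigma @^-1` [set s]) `&` (random_vector lambda @^-1` C s).
have mE s : measurable (E s).
  apply: measurableI; first exact: (hsigma s).1.
  exact: measurable_random_vector_preimage.
have XE : (fun w => subvector iota (unordered lambda sigma w)) @^-1` B =
    \bigcup_(s in [set: 'S_M]) E s.
  have BC w : B (subvector iota (unordered lambda sigma w)) =
      C (sigma w) (random_vector lambda w).
    by rewrite /C /=; congr B; apply: eq_from_tnth => i; rewrite !tnth_mktuple.
  apply/seteqP; split=> w /=; first by rewrite BC; exists (sigma w).
  by move=> [s _ [/= <-]]; rewrite BC.
have trivE : trivIset setT E by move=> s s' _ _ [w [[/= <- _] [/= <- _]]].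
rewrite XE measure_fin_bigcup //; last exact: finite_finset.
rewrite (_ : [set: 'S_M] = [set` index_enum 'S_M]); last first.
  by apply/seteqP; split=> s _ //=; rewrite mem_index_enum.
rewrite -fsbig_seq ?index_enum_uniq //; apply: eq_bigr => s _.
have PE : P (E s) = (((M`!%:R)^-1)%:E * P (random_vector lambda @^-1` C s))%E.
  by rewrite hindep // (hsigma s).2.
exact: PE.
Qed.

End unordered_law.

Theorem theorem4p3 (R : realType) (d : measure_display)
  (Omega : measurableType d) (P : probability Omega R)
  (M N L : nat) (alpha beta : \bar R)
  (Phi : 'I_M -> R -> R[i]) (Psi : 'I_N -> R -> R[i])
  (Psibar : 'I_N -> 'I_N -> R[i]) (xi : R -> R[i]) (K : R[i])
  (lambda : 'I_M -> {RV P >-> R}) (sigma : Omega -> 'S_M)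
  (iota : 'I_L -> 'I_M)
  (hMN : (1 <= M <= N)%N) (hLM : (1 <= L <= M)%N)
  (hab : (alpha < beta)%E)
  (hlambda : forall w, ordered_region alpha beta (random_vector lambda w))
  (hpdf : is_joint_pdf P (random_vector lambda)
            (ordered_region alpha beta (n:=M))
            (ordered_density Phi Psi Psibar xi K))
  (hint : forall i j k : 'I_N, (L <= k < M)%N ->
     Cintegrable (segment alpha beta)
       (fun t => varsigma Phi xi i t * Psi j t))
  (hsigma : uniform_perm P sigma)
  (hindep : perm_independent P sigma (random_vector lambda))
  (hiota : injective iota) :
  is_joint_pdf P (fun w => subvector iota (unordered lambda sigma w))
    (box alpha beta (n:=L))
    (fun x => K / M`!%:R *
       pseudo_det (tensor Phi Psi Psibar xi alpha beta x)).
Proof.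
case/andP: hMN => _ MN; case/andP: hLM => _ LM.
have [m ME] : exists m, M = (m + L)%N by exists (M - L)%N; rewrite subnK.
subst M; have [pdf0 mpdf pdfE] := hpdf.
pose T n (x : rtuple R n) := tensor_det Phi Psi Psibar xi alpha beta x.
pose dens := ordered_density Phi Psi Psibar xi K.
pose g z := (complex.Re (dens z))%:E.
pose Ord := ordered_region alpha beta (n:=(m + L)).
have mOrd : measurable Ord by exact: measurable_ordered_region.
have densE z : dens z = K * T _ z by rewrite /T tensor_det_full.
have dens_perm (s : 'S_(m + L)) z : dens (subvector s z) = dens z.
  by rewrite !densE /T tensor_det_perm.
have dens_tie (z : rtuple R (m + L)) : ~~ uniq z -> dens z = 0.
  exact: ordered_density_tie.
(* Any point of the box can be sorted without changing the density. *)
have dens0 z : box alpha beta z -> 0 <= dens z.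
  by move=> /exists_ordering[s os]; rewrite -(dens_perm s); exact: pdf0.
pose phi := g \_ Ord.
have phi0 z : (0 <= phi z)%E.
  rewrite /phi /patch; case: ifPn => // /set_mem /pdf0.
  by rewrite lecE lee_fin => /andP[].
have mphi : measurable_fun setT phi.
  by apply/(measurable_restrictT g mOrd)/measurable_EFinP.
pose marg n := @marginal R _ _ Phi Psi Psibar xi alpha beta K n.
have margE z : marg _ z = (\sum_(s : 'S_(m + L)) phi (subvector s z))%E.
  rewrite sum_orderings.
  - by rewrite /marg /marginal /patch /g densE.
  - by move=> s y; rewrite /g dens_perm.
  - by move=> y /dens_tie; rewrite /g => ->.
have mphis (s : 'S_(m + L)) :
    measurable_fun setT (fun z => phi (subvector s z)).
  by apply: measurableT_comp => //; exact: measurable_subvector.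
have mmarg : measurable_fun setT (marg (m + L)%N).
  rewrite (_ : marg _ = fun z => \sum_(s : 'S_(m + L)) phi (subvector s z))%E;
    last exact/funext.
  exact: emeasurable_sum.
have T0 (z : rtuple R (m + L)) : box alpha beta z -> 0 <= K * T _ z.
  by rewrite -densE; exact: dens0.
have int n : (L <= n < m + L)%N -> forall i j : 'I_N,
    Cintegrable (segment alpha beta) (fun t => varsigma Phi xi i t * Psi j t).
  move=> LnM i j; have /andP[_ nM] := LnM.
  exact: (hint i j (Ordinal (leq_trans nM MN))).
have LLM : (L <= L <= m + L)%N by rewrite leqnn.
have [TL0 mL] := marginal_pos_measurable MN int T0 mmarg LLM.
(* The constant 1 / M! is real, so it factors out of the real part. *)
have fE x : complex.Re (K / (m + L)`!%:R * T L x) =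
    ((m + L)`!%:R)^-1 * complex.Re (K * T L x).
  rewrite mulrAC -[_%:R^-1](_ : (((m + L)`!%:R)^-1)%:C = _); last first.
    by rewrite fmorphV rmorph_nat.
  by rewrite mulrC; case: (K * _) => u v /=; rewrite mul0r subr0.
have mReT : measurable_fun (box alpha beta (n:=L))
    (fun x => complex.Re (K * T L x)).
  by apply/measurable_EFinP/measurable_restrictT => //; exact: measurable_box.
split=> [x xb||B mB].
- by rewrite mulrAC divr_ge0 ?ler0n //; exact: TL0.
- under eq_fun do rewrite fE.
  exact: measurable_funM.
rewrite prob_subvector_unordered //.
have [tau tauE] := extend_injection_perm hiota.
pose B' := subvector (R := R) (@rshift m L) @^-1` B.
have mB' : measurable B' by exact: measurable_preimage_subvector.
(* The permutation tau carries the last L indices to the chosen ones, so the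
   change of variables by tau * s turns the event into one, B', that no longer
   depends on s. *)
have PE (s : 'S_(m + L)) :
    P (random_vector lambda @^-1` (subvector (R := R) (s \o iota) @^-1` B)) =
    (\int[lebesgue_tuple (m + L)]_(z in B')
       phi (subvector (tau * s)^-1%g z))%E.
  have -> : subvector (R := R) (s \o iota) @^-1` B =
      subvector (R := R) (tau * s)%g @^-1` B'.
    apply/seteqP; split=> z; rewrite /B' /= subvector_comp; congr B;
      by apply: eq_from_tnth => i; rewrite !tnth_mktuple /= permM tauE.
  have mC : measurable (subvector (R := R) (tau * s)%g @^-1` B').
    exact: measurable_preimage_subvector.
  rewrite pdfE // integral_mkcondr (_ : _ \_ _ = phi) //.
  rewrite [LHS](ge0_integral_lebesgue_tuple_perm (tau * s)^-1%g) //; last first.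
    exact: measurable_funTS.
  suff -> : subvector (R := R) (tau * s)^-1%g @^-1`
      (subvector (R := R) (tau * s)%g @^-1` B') = B' by [].
  by apply/seteqP; split=> z; rewrite /= subvector_permK.
under eq_bigr do rewrite PE.
rewrite -ge0_sume_distrr; last by move=> s _; exact: integral_ge0.
(* Reindexing by s |-> tau^-1 * s^-1 turns (tau * s)^-1 into s, and the sum of
   the integrands becomes the symmetric density on the box. *)
have reinj : injective (fun s : 'S_(m + L) => tau^-1 * s^-1)%g.
  by move=> s s' /mulgI/invg_inj.
rewrite (reindex_inj reinj) /=.
under eq_bigr do rewrite mulKVg invgK.
rewrite -ge0_integral_sum //; last by move=> s; exact: measurable_funTS.
under eq_integral do rewrite -margE.
rewrite integral_marginal // -ge0_integralZl_EFin //.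
- rewrite [RHS]integral_mkcondr; apply: eq_integral => x _.
  rewrite /marginal /patch; case: ifP => _; last by rewrite mule0.
  by rewrite -EFinM -fE.
- by move=> x _; exact: marginal_ge0.
- exact: measurable_funTS.
Qed.
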